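(* Let $\mathbb K$ be an infinite field, $m\geq n+1$, $\mathrm{char}(\mathbb K)\nmid m$, and let $l_1,\ldots,l_m\in R=\mathbb K[x_1,\ldots,x_n]$ be linear forms defining a generic arrangement, with $l_i=x_i$ for $1\leq i\leq n$. Let $A$ be the $(m-n)\times n$ matrix over $\mathbb K$ with $A\,[x_1\ \cdots\ x_n]^t=[l_{n+1}\ \cdots\ l_m]^t$, let $\Gamma$ be the $m\times(m-1)$ matrix whose first $m-1$ rows form the diagonal matrix with diagonal entries $-l_1,-l_2,\ldots,-l_{m-1}$ (that is, $-x_1,\ldots,-x_n,-l_{n+1},\ldots,-l_{m-1}$) and whose last row is $[l_m\ \cdots\ l_m]$, and let $$\mathfrak S=[\,-A\ |\ \mathbb I_{m-n}\,]\;\Gamma,$$ an $(m-n)\times(m-1)$ matrix. Then $$I_{m-n}(\mathfrak S)=\langle x_1,\ldots,x_n\rangle^{m-n}.$$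
   Context: Generic means that the $l_i$ are distinct and define a central arrangement of rank $n$ such that any $n$ among $l_1,\ldots,l_m$ are $\mathbb K$-linearly independent. $\mathbb I_r$ is the $r\times r$ identity matrix, $[\,-A\ |\ \mathbb I_{m-n}\,]$ is the two-block $(m-n)\times m$ matrix, and $I_r(\cdot)$ denotes the ideal generated by the $r\times r$ minors of a matrix. By convention $\mathrm{char}(\mathbb K)\nmid m$ holds when $\mathrm{char}(\mathbb K)=0$. *)

(* Defs.v *)
From HB Require Import structures.
From mathcomp Require Import all_boot all_order all_fingroup all_algebra.
From mathcomp.multinomials Require Import mpoly.
Set Implicit Arguments.
Unset Strict Implicit.
Unset Printing Implicit Defensive.
Import GRing.Theory.
Local Open Scope ring_scope.

Definition infinite_type (T : eqType) : Prop :=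
  forall s : seq T, exists x : T, x \notin s.

Section Ideals.
Variable R : comNzRingType.
Implicit Types (G J : R -> Prop) (p : R).

Definition ideal_gen G p : Prop :=
  exists (k : nat) (c g : 'I_k -> R),
    (forall i, G (g i)) /\ p = \sum_(i < k) c i * g i.

(* The unit ideal when r = 0. *)
Definition ideal_pow J (r : nat) : R -> Prop :=
  ideal_gen (fun q => exists f : 'I_r -> R,
    (forall i, J (f i)) /\ q = \prod_(i < r) f i).

(* Strictly increasing f and g select r rows and r columns of M. *)
Definition is_minor (p q : nat) (M : 'M[R]_(p, q)) (r : nat) (d : R) : Prop :=
  exists (f : 'I_r -> 'I_p) (g : 'I_r -> 'I_q),
    [/\ {homo f : i j / (i < j)%N}, {homo g : i j / (i < j)%N}
      & d = \det (mxsub f g M)].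

Definition minor_ideal (r p q : nat) (M : 'M[R]_(p, q)) : R -> Prop :=
  ideal_gen (is_minor M r).

End Ideals.

Section Arrangements.
Variables (K : fieldType) (n m : nat).
Implicit Type l : 'I_m -> {mpoly K[n]}.

Definition coef_mx l : 'M[K]_(m, n) := \matrix_(i, j) (l i)@_U_(j).

(* Being forms of degree 1, the l i vanish at the origin: the arrangement is
   central. Its rank is the codimension of the intersection of the hyperplanes
   l i = 0, i.e. the rank of the coefficient matrix. *)
Definition generic_arrangement l : Prop :=
  [/\ forall i, l i \is 1.-homog,
      injective l,
      \rank (coef_mx l) = n
    & forall B : {set 'I_m}, #|B| = n ->
        forall c : 'I_m -> K, \sum_(i in B) c i *: l i = 0 ->
        forall i, i \in B -> c i = 0].

(* The row of index m.-1 is the last one, so its entries l i are all the last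
   form. *)
Definition Gamma_mx l : 'M[{mpoly K[n]}]_(m, m.-1) :=
  \matrix_(i, j) if i == m.-1 :> nat then l i
                 else if i == j :> nat then - l i else 0.

(* [-A | 1] Gamma, with k standing for m - n. *)
Definition frakS_mx (k : nat) (e : (n + k = m)%N) (A : 'M[K]_(k, n)) l :
    'M[{mpoly K[n]}]_(k, m.-1) :=
  map_mx (@mpolyC n K) (castmx (erefl k, e) (row_mx (- A) 1%:M)) *m Gamma_mx l.

Definition vars_ideal : {mpoly K[n]} -> Prop :=
  ideal_gen (fun p => exists j : 'I_n, p = 'X_j).

End Arrangements.

(* Main.v *)
(** Put B = [-A | 1] and let C be the k x m matrix (k = m - n) whose j-th column
    is -l_j times that of B. The relations B l = 0 say that the columns of C sum
    to 0, and the j-th column of S = B Gamma is C_j - C_m. Hence the columns of S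
    sum to -m C_m, so that, m being invertible in K, C = S N for some matrix N,
    and the maximal minors of C lie in the ideal of those of S. The minor of C on
    a set P of k columns is a scalar times the product of the l_j, j in P; the
    scalar is nonzero by genericity. Finally, products of k = m - n of the m
    forms generate the k-th power of the ideal of the variables, by induction on
    k: any n of the forms span the variables. *)
Require Import Defs.
From mathcomp Require Import all_boot all_order all_fingroup all_algebra.
From mathcomp.multinomials Require Import mpoly.
Set Implicit Arguments.
Unset Strict Implicit.
Unset Printing Implicit Defensive.
Import GRing.Theory.
Local Open Scope ring_scope.

(** * Increasing enumerations of sets of indices *)

Lemma set_increasing_enum q k (J : {set 'I_q}) : #|J| = k ->
  exists2 g : 'I_k -> 'I_q, {homo g : i j / (i < j)%N} & J = [set g i | i : 'I_k].
Proof.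
move=> <-; exists (@enum_val _ (mem J)) => [i j lt_ij|]; last first.
  apply/setP=> x; apply/idP/imsetP => [xJ|[i _ ->]]; last exact: enum_valP.
  by exists (enum_rank_in xJ x) => //; rewrite enum_rankK_in.
have sJ : sorted ltn (map val (enum J)).
  have : sorted (relpre val ltn) (enum 'I_q).
    by rewrite -sorted_map val_enum_ord iota_ltn_sorted.
  have -> : enum J = [seq x <- enum 'I_q | x \in J] by rewrite [enum 'I_q]enumT.
  move=> sE; rewrite sorted_map; apply: sorted_filter sE => y x z.
  exact: ltn_trans.
have x0 : 'I_q := enum_val i; rewrite !(enum_val_nth x0).
have := sorted_ltn_nth ltn_trans 0%N sJ (i : nat) (j : nat).
rewrite !inE !size_map -!cardE !ltn_ord => /(_ isT isT lt_ij).
by rewrite !(nth_map x0) // -cardE.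
Qed.

Lemma homo_ord_inj k q (g : 'I_k -> 'I_q) :
  {homo g : i j / (i < j)%N} -> injective g.
Proof.
move=> g_incr i j eq_g; apply/val_inj.
by case: (ltngtP i j) => // /g_incr; rewrite eq_g ltnn.
Qed.

(** * Generated ideals, maximal minors and powers of ideals *)

Section IdealTheory.
Variable R : comNzRingType.
Implicit Types (G H : R -> Prop) (x y c : R).

Lemma ideal_gen0 G : ideal_gen G 0.
Proof.
exists 0, (fun=> 0), (fun=> 0); split; first by case.
by rewrite big_ord0.
Qed.

Lemma ideal_genD G x y : ideal_gen G x -> ideal_gen G y -> ideal_gen G (x + y).
Proof.
move=> [k1 [c1 [g1 [Gg1 ->]]]] [k2 [c2 [g2 [Gg2 ->]]]].
exists (k1 + k2)%N.
exists (fun i => match split i with inl a => c1 a | inr b => c2 b end).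
exists (fun i => match split i with inl a => g1 a | inr b => g2 b end).
split=> [i|]; first by case: (split i).
rewrite big_split_ord /=; congr (_ + _); apply: eq_bigr => i _.
  by have /= -> := unsplitK (inl i : 'I_k1 + 'I_k2).
by have /= -> := unsplitK (inr i : 'I_k1 + 'I_k2).
Qed.

Lemma ideal_genMl G c x : ideal_gen G x -> ideal_gen G (c * x).
Proof.
move=> [k [a [g [Gg ->]]]]; exists k, (fun i => c * a i), g; split=> //.
by rewrite mulr_sumr; apply: eq_bigr => i _; rewrite mulrA.
Qed.

Lemma mem_ideal_gen G x : G x -> ideal_gen G x.
Proof.
move=> Gx; exists 1%N, (fun=> 1), (fun=> x); split=> //.
by rewrite big_ord1 mul1r.
Qed.

Lemma ideal_gen_sum G (I : Type) (r : seq I) (P : pred I) (F : I -> R) :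
  (forall i, P i -> ideal_gen G (F i)) -> ideal_gen G (\sum_(i <- r | P i) F i).
Proof.
move=> GF; apply: big_ind => //; first exact: ideal_gen0.
exact: ideal_genD.
Qed.

Lemma ideal_gen_le G H x :
  (forall y, G y -> ideal_gen H y) -> ideal_gen G x -> ideal_gen H x.
Proof.
move=> GH [k [c [g [Gg ->]]]]; apply: ideal_gen_sum => i _.
by apply: ideal_genMl; apply: GH.
Qed.

(** The multilinear half of the Cauchy-Binet formula: terms with a repeated row are kept, and the
    terms with the same set of rows are not grouped. *)
Lemma det_mulmx_rowsub k q (A : 'M[R]_(k, q)) (B : 'M[R]_(q, k)) :
  \det (A *m B) =
  \sum_(f : {ffun 'I_k -> 'I_q}) (\prod_i A i (f i)) * \det (rowsub f B).
Proof.
under [RHS]eq_bigr => f _ do rewrite mulr_sumr.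
rewrite exchange_big /=; apply: eq_bigr => s _.
under eq_bigr => i _ do rewrite mxE.
rewrite bigA_distr_bigA mulr_sumr; apply: eq_bigr => f _.
rewrite big_split /= mulrCA; congr (_ * (_ * _)).
by apply: eq_bigr => i _; rewrite mxE.
Qed.

(** Minors select columns in increasing order. A repeated column makes the determinant zero;
    otherwise sorting the columns only costs a sign. *)
Lemma det_colsub_minor k q (S : 'M[R]_(k, q)) (f : 'I_k -> 'I_q) :
  minor_ideal k S (\det (colsub f S)).
Proof.
have [/injectiveP f_inj|/injectivePn [i [j ne_ij eq_f]]] := boolP (injectiveb f);
    last first.
  rewrite -det_tr (determinant_alternate ne_ij); first exact: ideal_gen0.
  by move=> t; rewrite !mxE eq_f.
have card_f : #|[set f i | i : 'I_k]| = k by rewrite card_imset ?card_ord.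
have [g g_incr eq_fg] := set_increasing_enum card_f.
(* A sigma type rather than a mere existential, so that the sorting permutation [s] can be defined
   from it. *)
have g_ex i : {j | f i = g j}.
  apply: sig_eqW; have /imsetP [j _ ->] : f i \in [set g i | i : 'I_k].
    by rewrite -eq_fg imset_f.
  by exists j.
pose s i := sval (g_ex i); have fE i : f i = g (s i) := svalP (g_ex i).
have s_inj : injective s by move=> i j eq_s; apply: f_inj; rewrite !fE eq_s.
have -> : colsub f S = (row_perm (perm s_inj) (colsub g S)^T)^T.
  by apply/matrixP=> i j; rewrite !mxE permE fE.
rewrite det_tr row_permE det_mulmx det_tr; apply: ideal_genMl.
by apply: mem_ideal_gen; exists id, g; split.
Qed.

(** After transposition, each term of the row expansion is a multiple of a determinant of [k]
    columns of [S]. *)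
Lemma det_mulmx_minor k q (S : 'M[R]_(k, q)) (N : 'M[R]_(q, k)) :
  minor_ideal k S (\det (S *m N)).
Proof.
rewrite -det_tr trmx_mul det_mulmx_rowsub; apply: ideal_gen_sum => f _.
apply: ideal_genMl; rewrite -det_tr.
have -> : (rowsub f S^T)^T = colsub f S by apply/matrixP=> i j; rewrite !mxE.
exact: det_colsub_minor.
Qed.

(* As the columns of C sum to 0, those of S sum to -(q + 1) times the last
   column of C. *)
Lemma mulmx_recover_cols k q (C : 'M[R]_(k, q.+1)) (S : 'M[R]_(k, q)) (c : R) :
    c * q.+1%:R = 1 -> (forall i, \sum_j C i j = 0) ->
    (forall i j, S i j = C i (widen_ord (leqnSn q) j) - C i ord_max) ->
  C = S *m (\matrix_(i, j) ((i == j :> nat)%:R - c)).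
Proof.
move=> cq C0 SE; apply/matrixP=> i j; rewrite mxE.
under eq_bigr => t _ do rewrite SE mxE.
(* The added term [t = q] is zero, and the full sum over the columns of [C] makes [C0]
   applicable. *)
transitivity (\sum_(t < q.+1) (C i t - C i ord_max) * ((t == j :> nat)%:R - c)).
  under eq_bigr => t _ do rewrite mulrBr.
  rewrite sumrB -mulr_suml sumrB C0 sub0r sumr_const card_ord -mulr_natr.
  rewrite (bigD1 j) //= eqxx mulr1 big1 ?addr0; last first.
    by move=> t ne_tj; rewrite [_ == _ :> nat](negPf ne_tj) mulr0.
  by rewrite mulNr opprK -mulrA [_ * c]mulrC cq mulr1 subrK.
by rewrite big_ord_recr /= subrr mul0r addr0.
Qed.

Lemma det_ideal_pow (J : R -> Prop) k (M : 'M[R]_k) :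
  (forall i j, J (M i j)) -> ideal_pow J k (\det M).
Proof.
move=> JM; apply: ideal_gen_sum => s _; apply: ideal_genMl.
by apply: mem_ideal_gen; exists (fun i => M i (s i)).
Qed.

(* Dropping one form l j at a time: the ideal of d-fold products of the
   remaining forms is J^d, and the l j generate J. *)
Lemma ideal_pow_products (I : finType) (l : I -> R) (J : R -> Prop) n :
    (forall (B : {set I}) x, (n <= #|B|)%N -> J x ->
       ideal_gen (fun y => exists2 j, j \in B & y = l j) x) ->
  forall d (B : {set I}) x, (n + d <= #|B|.+1)%N -> ideal_pow J d x ->
  ideal_gen (fun y => exists2 P : {set I},
    (P \subset B) && (#|P| == d) & y = \prod_(j in P) l j) x.
Proof.
move=> spanJ; elim=> [|d IHd] B x.
  rewrite addn0 => _ [k [c [g [Gg ->]]]]; apply: ideal_gen_sum => i _.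
  apply: ideal_genMl; apply: mem_ideal_gen; exists set0.
    by rewrite sub0set cards0.
  by have [f [_ ->]] := Gg i; rewrite big_ord0 big_set0.
rewrite addnS ltnS => leB; apply: ideal_gen_le => _ [f [Jf ->]].
have [|k [c [g [Gg f0E]]]] := spanJ B (f ord0) _ (Jf ord0).
  exact: leq_trans (leq_addr _ _) leB.
rewrite big_ord_recl f0E mulr_suml; apply: ideal_gen_sum => i _.
have [j jB ->] := Gg i.
rewrite -mulrA; apply: ideal_genMl.
have : ideal_pow J d (\prod_(t < d) f (lift ord0 t)).
  by apply: mem_ideal_gen; exists (fun t => f (lift ord0 t)).
(* Removing [j] from [B] keeps the factors of the product distinct. *)
move=> /(IHd (B :\ j)) [|k' [c' [g' [Gg' ->]]]].
  by rewrite (cardsD1 j B) jB in leB.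
rewrite mulr_sumr; apply: ideal_gen_sum => t _; rewrite mulrCA.
apply: ideal_genMl; apply: mem_ideal_gen.
have [P /andP [PB /eqP cardP] ->] := Gg' t.
have jP : j \notin P by apply/negP=> /(subsetP PB); rewrite !inE eqxx.
exists (j |: P); last by rewrite big_setU1.
rewrite cardsU1 jP cardP eqxx andbT subUset sub1set jB.
exact: subset_trans PB (subsetDl _ _).
Qed.

End IdealTheory.

(** * Linear forms any [n] of which are independent *)

Section LinearForms.
Variables (K : fieldType) (n m : nat) (l : 'I_m -> {mpoly K[n]}).
Hypothesis l_hom : forall i, l i \is 1.-homog.

Lemma homog1E (p : {mpoly K[n]}) :
  p \is 1.-homog -> p = \sum_j p@_U_(j) *: 'X_j.
Proof.
move=> p_hom; apply/mpolyP=> u; rewrite raddf_sum /=.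
under eq_bigr => j _ do rewrite mcoeffZ mcoeffX.
have [/mdeg1P [i /eqP ->]|u_deg] := boolP (mdeg u == 1%N).
  rewrite (bigD1 i) //= eqxx mulr1 big1 ?addr0 // => j ne_ji.
  by rewrite eq_mnm1 (negPf ne_ji) mulr0.
rewrite (dhomog_nemf_coeff p_hom u_deg) big1 // => j _.
by case: eqP => [uE|_]; [rewrite -uE mdeg1 in u_deg | rewrite mulr0].
Qed.

Hypothesis l_indep : forall B : {set 'I_m}, #|B| = n ->
  forall c : 'I_m -> K, \sum_(i in B) c i *: l i = 0 ->
  forall i, i \in B -> c i = 0.

Lemma coef_rowsub_unit (g : 'I_n -> 'I_m) :
  injective g -> rowsub g (coef_mx l) \in unitmx.
Proof.
move=> g_inj; rewrite -row_free_unit -kermx_eq0; apply/rowV0P => v /sub_kermxP v0.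
(* The vector [v] transported along [g] and extended by zero, since [l_indep] expects coefficients
   indexed by ['I_m]. *)
pose c j := \sum_(i | g i == j) v 0 i.
have cg i : c (g i) = v 0 i.
  by rewrite /c (eq_bigl (pred1 i)) ?big_pred1_eq // => t; rewrite (inj_eq g_inj).
apply/rowP=> i; rewrite mxE -cg.
apply: (@l_indep [set g i | i : 'I_n]); last by rewrite imset_f.
  by rewrite card_imset ?card_ord.
rewrite big_imset /=; last by move=> ? ? _ _; apply: g_inj.
under eq_bigr => t _ do rewrite cg (homog1E (l_hom _)) scaler_sumr.
rewrite exchange_big /= big1 // => j _.
under eq_bigr => t _ do rewrite scalerA.
rewrite -scaler_suml [X in X *: _](_ : _ = 0) ?scale0r //.
have /rowP/(_ j) := v0; rewrite !mxE => v0j; rewrite -[RHS]v0j.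
by apply: eq_bigr => t _; rewrite !mxE.
Qed.

(** Inverting the coefficient matrix of [n] forms taken from [B] writes each variable as a
    combination of them. *)
Lemma vars_ideal_span (B : {set 'I_m}) (x : {mpoly K[n]}) :
    (n <= #|B|)%N -> vars_ideal x ->
  ideal_gen (fun y => exists2 j, j \in B & y = l j) x.
Proof.
move=> leB; apply: ideal_gen_le => _ [j ->].
pose g (i : 'I_n) := enum_val (widen_ord leB i).
have g_inj : injective g by move=> a b /enum_val_inj [] /val_inj.
have uM := coef_rowsub_unit g_inj; set M := rowsub g _ in uM.
have -> : 'X_j = \sum_i (invmx M j i)%:MP * l (g i).
  under eq_bigr => i _ do rewrite mul_mpolyC (homog1E (l_hom _)) scaler_sumr.
  rewrite exchange_big /=.
  have coefE t : \sum_i invmx M j i *: ((l (g i))@_U_(t) *: 'X_t)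
               = (j == t)%:R *: 'X_t :> {mpoly K[n]}.
    under eq_bigr => i _ do rewrite scalerA.
    rewrite -scaler_suml; congr (_ *: _).
    have /matrixP/(_ j t) := mulVmx uM; rewrite !mxE => <-.
    by apply: eq_bigr => i _; rewrite !mxE.
  under eq_bigr => t _ do rewrite coefE.
  rewrite (bigD1 j) //= eqxx scale1r big1 ?addr0 // => t.
  by rewrite eq_sym => /negPf ->; rewrite scale0r.
apply: ideal_gen_sum => i _; apply: ideal_genMl; apply: mem_ideal_gen.
by exists (g i) => //; apply: enum_valP.
Qed.

(* A row vector killing the columns outside a set B of n indices gives a linear
   relation among the n forms indexed by B. *)
Lemma det_relations_neq0 k (B : 'M[K]_(k, m)) (g : 'I_k -> 'I_m) :
    (n + k = m)%N -> row_free B -> injective g ->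
    (forall i, \sum_j B i j *: l j = 0) ->
  \det (colsub g B) != 0.
Proof.
move=> nk B_free g_inj Bl; rewrite -unitfE -[_ \is a _]/(colsub g B \in unitmx).
rewrite -row_free_unit -kermx_eq0; apply/rowV0P => v /sub_kermxP v0.
(* It suffices that [v *m B] vanishes: on the image of [g] this is the choice of [v], and on the [n]
   remaining indices it follows from independence. *)
apply: (row_free_inj B_free); rewrite mul0mx.
have vg i : (v *m B) 0 (g i) = 0.
  have /rowP/(_ i) := v0; rewrite !mxE => v0i; rewrite -[RHS]v0i.
  by apply: eq_bigr => t _; rewrite !mxE.
pose J := [set g i | i : 'I_k].
have cardJ : #|~: J| = n.
  by apply: (@addnI k); rewrite [RHS]addnC nk -[RHS]card_ord -(cardsC J) card_imset ?card_ord.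
apply/rowP=> j; rewrite [RHS]mxE; have [/imsetP [i _ ->] //|jJ] := boolP (j \in J).
apply: (l_indep cardJ (c := fun j => (v *m B) 0 j)); last by rewrite inE.
transitivity (\sum_j (v *m B) 0 j *: l j).
  rewrite [RHS](bigID (mem J)) /= [X in _ = X + _]big1 ?add0r; last first.
    by move=> t /imsetP [i _ ->]; rewrite vg scale0r.
  by apply: eq_bigl => t; rewrite inE.
under eq_bigr => t _ do rewrite mxE scaler_suml.
rewrite exchange_big big1 // => i _.
under eq_bigr => t _ do rewrite -scalerA.
by rewrite -scaler_sumr Bl scaler0.
Qed.

End LinearForms.

(** * The equality of the two ideals *)

(** Of the block matrix only two properties are kept: its rows are independent, and they are
    relations among the forms. *)
Lemma minor_ideal_relations (K : fieldType) n q k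
    (l : 'I_q.+1 -> {mpoly K[n]}) (B : 'M[K]_(k, q.+1)) :
    (n + k = q.+1)%N -> q.+1%:R != 0 :> K -> (forall i, l i \is 1.-homog) ->
    (forall C : {set 'I_q.+1}, #|C| = n ->
       forall c : 'I_q.+1 -> K, \sum_(i in C) c i *: l i = 0 ->
       forall i, i \in C -> c i = 0) ->
    row_free B -> (forall i, \sum_j B i j *: l j = 0) ->
  forall p, minor_ideal k (map_mx (@mpolyC n K) B *m Gamma_mx l) p
            <-> ideal_pow (@vars_ideal K n) k p.
Proof.
move=> nk q_neq0 l_hom l_indep B_free Bl p; set S := _ *m _.
have l_vars i : vars_ideal (l i).
  rewrite (homog1E (l_hom i)); apply: ideal_gen_sum => j _.
  by rewrite -mul_mpolyC; apply/ideal_genMl/mem_ideal_gen; exists j.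
pose C : 'M[{mpoly K[n]}]_(k, q.+1) := \matrix_(i, j) ((B i j)%:MP * - l j).
have SE i j : S i j = C i (widen_ord (leqnSn q) j) - C i ord_max.
  rewrite !mxE big_ord_recr /= !mxE eqxx -mulrN opprK; congr (_ + _).
  rewrite (bigD1 j) //= !mxE /= eqxx ltn_eqF // big1 ?addr0 // => t ne_tj.
  by rewrite !mxE /= ltn_eqF // [_ == _ :> nat](negPf ne_tj) mulr0.
have C0 i : \sum_j C i j = 0.
  under eq_bigr => j _ do rewrite mxE mulrN mul_mpolyC.
  by rewrite sumrN Bl oppr0.
have C_vars a b : vars_ideal (C a b).
  by rewrite mxE mulrN -mulNr; apply/ideal_genMl/l_vars.
split; apply: ideal_gen_le => x.
  move=> [f [g [_ _ ->]]]; apply: det_ideal_pow => i j; rewrite mxE SE.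
  by rewrite -mulN1r; apply: ideal_genD; [|apply: ideal_genMl]; apply: C_vars.
move=> [f [fJ ->]].
have spanJ := vars_ideal_span l_hom l_indep.
have := ideal_pow_products spanJ (d := k) (B := setT) (x := \prod_i f i).
rewrite cardsT card_ord nk leqnSn => /(_ isT); case=> [|r [c [g [Gg ->]]]].
  by apply: mem_ideal_gen; exists f.
apply: ideal_gen_sum => i _; apply: ideal_genMl.
have [P /andP [_ /eqP cardP] ->] := Gg i.
have [h h_incr PE] := set_increasing_enum cardP.
have h_inj := homo_ord_inj h_incr.
have detB := det_relations_neq0 l_indep nk B_free h_inj Bl.
(* [C] is [B] times a diagonal matrix, and so are the selected columns; the sign gathers the [k]
   factors [- l j]. *)
have detC : \det (colsub h C) =
    (\det (colsub h B))%:MP * ((-1) ^+ k * \prod_(j in P) l j).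
  have -> : colsub h C =
      map_mx (@mpolyC n K) (colsub h B) *m diag_mx (\row_j - l (h j)).
    by apply/matrixP=> a b; rewrite mul_mx_diag !mxE.
  rewrite det_mulmx det_map_mx det_diag; congr (_ * _).
  under eq_bigr => j _ do rewrite mxE.
  rewrite prodrN card_ord PE big_imset //= => a b _ _; exact: h_inj.
have -> : \prod_(j in P) l j =
    ((-1) ^+ k * ((\det (colsub h B))^-1)%:MP) * \det (colsub h C).
  rewrite detC mulrA -[_ * _ * (\det _)%:MP]mulrA -mpolyCM mulVf // mpolyC1.
  by rewrite mulr1 mulrA -expr2 sqrr_sign mul1r.
apply: ideal_genMl.
have cq : (q.+1%:R^-1)%:MP * q.+1%:R = 1 :> {mpoly K[n]}.
  by rewrite -mpolyC_nat -mpolyCM mulVf.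
rewrite (mulmx_recover_cols cq C0 SE).
have -> N : colsub h (S *m N) = S *m colsub h N :> 'M[{mpoly K[n]}]_k.
  by apply/matrixP=> a b; rewrite !mxE; apply: eq_bigr => t _; rewrite !mxE.
exact: det_mulmx_minor.
Qed.

Theorem proposition2p2 (K : fieldType) (n m : nat)
  (K_infinite : infinite_type K)
  (lt_nm : (n.+1 <= m)%N)
  (char_m : forall p : nat, p \in [pchar K] -> ~~ (p %| m)%N)
  (l : 'I_m -> {mpoly K[n]})
  (l_generic : generic_arrangement l)
  (l_vars : forall i : 'I_n, l (cast_ord (subnKC (ltnW lt_nm)) (lshift (m - n) i)) = 'X_i)
  (A : 'M[K]_(m - n, n))
  (A_l : map_mx (@mpolyC n K) A *m (\col_j 'X_j)
         = \col_(i < m - n) l (cast_ord (subnKC (ltnW lt_nm)) (rshift n i))) :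
  forall p : {mpoly K[n]},
    minor_ideal (m - n) (frakS_mx (subnKC (ltnW lt_nm)) A l) p
    <-> ideal_pow (@vars_ideal K n) (m - n) p.
Proof.
have [l_hom _ _ l_indep] := l_generic.
(* With [m - n] replaced by a variable [k], case analysis on [e : n + k = m] can remove the
   casts. *)
move: (subnKC _) l_vars A_l => e; move: (m - n)%N => k in e A *.
move=> l_vars A_l; rewrite /frakS_mx.
set B := castmx _ _.
have BE i (j : 'I_(n + k)) : B i (cast_ord e j) = row_mx (- A) 1%:M i j.
  by rewrite castmxE /= cast_ord_id cast_ordK.
have B_free : row_free B.
  apply/row_freeP; exists (castmx (e, erefl k) (col_mx 0 1%:M)).
  rewrite /B; case: _ / e {B BE l_vars A_l} => /=.
  by rewrite !castmx_id mul_row_col mulmx0 add0r mulmx1.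
have Bl i : \sum_j B i j *: l j = 0.
  rewrite (reindex (cast_ord e)) /=; last first.
    by exists (cast_ord (esym e)) => j _; rewrite ?cast_ordK ?cast_ordKV.
  under eq_bigr => j _ do rewrite BE.
  rewrite big_split_ord /=.
  under eq_bigr => j _ do rewrite row_mxEl l_vars mxE scaleNr -mul_mpolyC.
  under [X in _ + X]eq_bigr => j _ do rewrite row_mxEr mxE.
  rewrite sumrN (bigD1 i) //= eqxx scale1r [X in _ + (_ + X)]big1 ?addr0; last first.
    by move=> j; rewrite eq_sym => /negPf ->; rewrite scale0r.
  have /matrixP/(_ i 0) := A_l; rewrite !mxE => <-.
  by apply/eqP; rewrite addrC subr_eq0; apply/eqP/eq_bigr => j _; rewrite !mxE.
(* If the positive integer [m] were zero in [K], the characteristic would be a prime dividing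
   [m]. *)
have m_neq0 : m%:R != 0 :> K.
  apply/negP=> m0; have [p pK] := natf0_pchar (leq_ltn_trans (leq0n n) lt_nm) m0.
  by have := char_m p pK; rewrite (dvdn_pcharf pK) m0.
move: B B_free Bl {BE l_vars A_l char_m l_generic}.
(* Writing [m] as [q.+1] lets [m.-1] reduce to [q]. *)
case: m lt_nm l e l_hom l_indep m_neq0 => // q _ l e l_hom l_indep m_neq0 B.
by move=> B_free Bl; apply: minor_ideal_relations.
Qed.
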